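(* Let $\mathbf J$ be the set of all real $4\times2$ matrices $J=(J_{\alpha j})$ with $|J_{\alpha j}-(J_{\mathrm c})_{\alpha j}|\le(J_{\mathrm{rad}})_{\alpha j}$ for all $\alpha,j$, where $$J_{\mathrm c}=\begin{pmatrix}-0.30787068218&-0.18575144897\\0.50424122365&0.30423065863\\-0.14093625628&-0.084561820768\\0.69791494720&0.41874838795\end{pmatrix},\qquad J_{\mathrm{rad}}=\begin{pmatrix}3.45\cdot10^{-7}&2.07\cdot10^{-7}\\8.29\cdot10^{-7}&5.00\cdot10^{-7}\\3.82\cdot10^{-7}&2.31\cdot10^{-7}\\1.03\cdot10^{-6}&6.18\cdot10^{-7}\end{pmatrix}.$$ For every $J\in\mathbf J$ set $G=J^{\mathsf T}J$. Then, entrywise, $$G\in\begin{pmatrix}[0.8559892765,\,0.8559944643]&[0.5147600907,\,0.5147632101]\\ [0.5147600907,\,0.5147632101]&[0.3095598706,\,0.3095617462]\end{pmatrix},$$ and $$\det G\in[1.9743508816,\,1.9829741725]\cdot10^{-6}.$$ Consequently every $J\in\mathbf J$ has column rank two, and $$\lambda_{\min}(G)\ge1.6939130553\cdot10^{-6},\qquad\lambda_{\max}(G)\le1.1655562105.$$ Equivalently, $\sigma_{\min}(J)\ge1.3015041511\cdot10^{-3}>5\cdot10^{-4}$, and $\kappa(J)\le829.509$.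
   Context: $\lambda_{\min}(G),\lambda_{\max}(G)$ denote the smallest and largest eigenvalues of the symmetric $2\times2$ matrix $G$; $\sigma_{\min}(J)=\sqrt{\lambda_{\min}(G)}$ is the smallest singular value of $J$, and $\kappa(J)=\sqrt{\lambda_{\max}(G)/\lambda_{\min}(G)}$ its condition number. *)

(* Defs.v *)
(* MathComp matrices over Stdlib's real numbers [R], which [Rstruct] equips with
   the [realType] structure. *)
From Stdlib Require Export Rdefinitions.
From mathcomp Require Export all_boot all_order all_algebra.
From mathcomp Require Export boolp classical_sets reals.
From mathcomp Require Export Rstruct.
From mathcomp Require Import ring lra.

Set Implicit Arguments.
Unset Strict Implicit.
Unset Printing Implicit Defensive.

Export Order.TTheory GRing.Theory Num.Theory.

(* Loading Stdlib's reals takes over the keys [%R] and [%N]; restore MathComp's.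
   Decimal literals are Stdlib's, written [x%coqR]. *)
Delimit Scope nat_scope with N.
Delimit Scope ring_scope with R.
Delimit Scope R_scope with coqR.

Open Scope classical_set_scope.
Open Scope ring_scope.

Definition Jc : 'M[R]_(4, 2) := \matrix_(a, j)
  nth 0 (nth [::] [:: [:: -0.30787068218; -0.18575144897];
                      [:: 0.50424122365; 0.30423065863];
                      [:: -0.14093625628; -0.084561820768];
                      [:: 0.69791494720; 0.41874838795]]%coqR a) j.

Definition Jrad : 'M[R]_(4, 2) := \matrix_(a, j)
  nth 0 (nth [::] [:: [:: 3.45e-7; 2.07e-7];
                      [:: 8.29e-7; 5.00e-7];
                      [:: 3.82e-7; 2.31e-7];
                      [:: 1.03e-6; 6.18e-7]]%coqR a) j.

Definition Jbox : set 'M[R]_(4, 2) :=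
  [set J | forall a j, `|J a j - Jc a j| <= Jrad a j].

(* The infimum and supremum are attained whenever the spectrum is nonempty; for
   the symmetric 2 x 2 matrices used here see [lambda_min_least] and
   [lambda_max_greatest]. *)
Definition lambda_min n (G : 'M[R]_n) : R := inf [set x | eigenvalue G x].
Definition lambda_max n (G : 'M[R]_n) : R := sup [set x | eigenvalue G x].

Definition sigma_min m n (J : 'M[R]_(m, n)) : R :=
  Num.sqrt (lambda_min (J^T *m J)).

Definition kappa m n (J : 'M[R]_(m, n)) : R :=
  Num.sqrt (lambda_max (J^T *m J) / lambda_min (J^T *m J)).

Lemma eigenvalue_mx2 (G : 'M[R]_2) (z : R) :
  eigenvalue G z = ((G 0 0 - z) * (G 1 1 - z) - G 0 1 * G 1 0 == 0).
Proof.
rewrite /eigenvalue /eigenspace kermx_eq0 row_free_unit unitmxE unitfE negbK.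
rewrite (expand_det_row _ 0) !big_ord_recl big_ord0 /cofactor !det_mx11 !mxE.
have e1 : lift 0 0 = 1 :> 'I_2 by exact/val_inj.
have e2 : lift 1 0 = 0 :> 'I_2 by exact/val_inj.
rewrite e1 e2 /= expr0 expr1 addr0 !mulr1n !mulr0n !subr0.
by rewrite !mul1r mulN1r mulrN.
Qed.

Lemma eigenvalue_sym2 (G : 'M[R]_2) : G^T = G ->
  exists x y, x <= y /\ [set z | eigenvalue G z] = [set x; y].
Proof.
move=> symG; have eG10 : G 1 0 = G 0 1 by rewrite -[in LHS]symG mxE.
pose t := G 0 0 + G 1 1; pose d := (G 0 0 - G 1 1) ^+ 2 + 4%:R * G 0 1 ^+ 2.
have d_ge0 : 0 <= d by apply: addr_ge0; [|apply: mulr_ge0]; rewrite ?ler0n ?sqr_ge0.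
pose s := Num.sqrt d; have s_ge0 : 0 <= s := sqrtr_ge0 d.
have s2 : s ^+ 2 = d by rewrite sqr_sqrtr.
exists ((t - s) / 2%:R), ((t + s) / 2%:R); split; first by lra.
apply/seteqP; split => z /=; rewrite eigenvalue_mx2 eG10.
  move=> /eqP e0.
  have /eqP : (z - (t - s) / 2%:R) * (z - (t + s) / 2%:R) = 0.
    by move: s2 e0; rewrite /t /d; nra.
  by rewrite mulf_eq0 !subr_eq0 => /orP[]/eqP; [left | right].
by case=> ->; apply/eqP; move: s2; rewrite /t /d; nra.
Qed.

Lemma lambda_min_least (G : 'M[R]_2) : G^T = G ->
  eigenvalue G (lambda_min G) /\
  forall z, eigenvalue G z -> lambda_min G <= z.
Proof.
move=> /eigenvalue_sym2[x [y [lexy eG]]].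
have ev z : eigenvalue G z <-> z = x \/ z = y.
  by have := congr1 (fun A => A z) eG => /= ->.
suff -> : lambda_min G = x.
  by split=> [|z /ev[]->//]; apply/ev; left.
rewrite /lambda_min eG; apply/eqP; rewrite eq_le; apply/andP; split.
  by apply: ge_inf; [exists x => z [] -> | left].
by apply: lb_le_inf; [exists x; left | move=> z [] ->].
Qed.

Lemma lambda_max_greatest (G : 'M[R]_2) : G^T = G ->
  eigenvalue G (lambda_max G) /\
  forall z, eigenvalue G z -> z <= lambda_max G.
Proof.
move=> /eigenvalue_sym2[x [y [lexy eG]]].
have ev z : eigenvalue G z <-> z = x \/ z = y.
  by have := congr1 (fun A => A z) eG => /= ->.
suff -> : lambda_max G = y.
  by split=> [|z /ev[]->//]; apply/ev; right.
rewrite /lambda_max eG; apply/eqP; rewrite eq_le; apply/andP; split.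
  by apply: ge_sup; [exists x; left | move=> z [] ->].
by apply: ub_le_sup; [exists y => z [] -> | right].
Qed.

(* Main.v *)
From Stdlib Require Lra.
Require Import Defs.
From mathcomp Require Import lra.

Set Implicit Arguments.
Unset Strict Implicit.

(* The columns of [J] are nearly parallel, so [\det G] is tiny compared with the
   entries of [G] and cannot be enclosed from the enclosures of the latter.
   Lagrange's identity writes it as the sum of the squared 2 x 2 minors of [J],
   for which plain interval arithmetic is sharp enough.  The eigenvalues of [G]
   then satisfy [lambda_max <= \tr G] and [lambda_min >= \det G / \tr G]. *)

Section StdlibReals.
Local Open Scope R_scope.

Lemma Rmult_itv a b c d x y : 0 <= a -> 0 <= c ->
  a <= x <= b -> c <= y <= d -> a * c <= x * y <= b * d.
Proof.
move=> a0 c0 [ax xb] [cy yd].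
by split; apply: RIneq.Rmult_le_compat => //; Lra.lra.
Qed.

Lemma Rsqr_itv a b x : 0 <= a -> a <= x <= b -> a * a <= x * x <= b * b.
Proof. by move=> a0 abx; exact: Rmult_itv. Qed.

(** Serves the minors whose enclosure contains zero: their squares are bounded below only by 0. *)
Lemma Rsqr_itv_sym a b x : - b <= a -> a <= x <= b -> 0 <= x * x <= b * b.
Proof. by move=> ba [ax xb]; split; Lra.nra. Qed.

(** Minus the determinant with rows [(x, y)] and [(x', y')]; with this sign the four minors that
    dominate [\det G] are positive. *)
Definition minor2 x y x' y' := x' * y - x * y'.

Lemma minor2_itv a b c d a' b' c' d' x y x' y' :
  0 <= a -> 0 <= c -> 0 <= a' -> 0 <= c' ->
  a <= x <= b -> c <= y <= d -> a' <= x' <= b' -> c' <= y' <= d' ->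
  a' * c - b * d' <= minor2 x y x' y' <= b' * d - a * c'.
Proof.
move=> a0 c0 a'0 c'0 hx hy hx' hy'.
have := Rmult_itv a'0 c0 hx' hy; have := Rmult_itv a0 c'0 hx hy'.
by rewrite /minor2; Lra.lra.
Qed.

(* In [Jc] the rows 0 and 2 are negative; [x] and [y] are the columns of [J] with
   these two rows negated, which leaves [J^T *m J] unchanged. *)
Lemma gram_box (x0 x1 x2 x3 y0 y1 y2 y3 : R) :
  0.30787068218 - 3.45e-7 <= x0 <= 0.30787068218 + 3.45e-7 ->
  0.50424122365 - 8.29e-7 <= x1 <= 0.50424122365 + 8.29e-7 ->
  0.14093625628 - 3.82e-7 <= x2 <= 0.14093625628 + 3.82e-7 ->
  0.69791494720 - 1.03e-6 <= x3 <= 0.69791494720 + 1.03e-6 ->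
  0.18575144897 - 2.07e-7 <= y0 <= 0.18575144897 + 2.07e-7 ->
  0.30423065863 - 5.00e-7 <= y1 <= 0.30423065863 + 5.00e-7 ->
  0.084561820768 - 2.31e-7 <= y2 <= 0.084561820768 + 2.31e-7 ->
  0.41874838795 - 6.18e-7 <= y3 <= 0.41874838795 + 6.18e-7 ->
  let g00 := x0 * x0 + x1 * x1 + x2 * x2 + x3 * x3 in
  let g01 := x0 * y0 + x1 * y1 + x2 * y2 + x3 * y3 in
  let g11 := y0 * y0 + y1 * y1 + y2 * y2 + y3 * y3 in
  [/\ 0.8559892765 <= g00 <= 0.8559944643,
      0.5147600907 <= g01 <= 0.5147632101,
      0.3095598706 <= g11 <= 0.3095617462 &
      1.974356e-6 <= g00 * g11 - g01 * g01 <= 1.9829741725e-6].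
Proof.
move=> hx0 hx1 hx2 hx3 hy0 hy1 hy2 hy3 g00 g01 g11.
split.
- have := Rsqr_itv _ hx0; have := Rsqr_itv _ hx1.
  have := Rsqr_itv _ hx2; have := Rsqr_itv _ hx3.
  by rewrite /g00; Lra.lra.
- have := Rmult_itv _ _ hx0 hy0; have := Rmult_itv _ _ hx1 hy1.
  have := Rmult_itv _ _ hx2 hy2; have := Rmult_itv _ _ hx3 hy3.
  by rewrite /g01; Lra.lra.
- have := Rsqr_itv _ hy0; have := Rsqr_itv _ hy1.
  have := Rsqr_itv _ hy2; have := Rsqr_itv _ hy3.
  by rewrite /g11; Lra.lra.
(* Rows 0 and 1 are nearly proportional, as are rows 2 and 3, so these two minors may vanish; the
   other four stay away from zero. All endpoints are interval bounds rounded outwards. *)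
have m01 : - 6.798e-7 <= minor2 x0 y0 x1 y1 <= 6.798e-7.
  by have := minor2_itv _ _ _ _ hx0 hy0 hx1 hy1; Lra.lra.
have m02 : 1.448079472e-4 <= minor2 x0 y0 x2 y2 <= 1.452087931e-4.
  by have := minor2_itv _ _ _ _ hx0 hy0 hx2 hy2; Lra.lra.
have m03 : 7.176903156e-4 <= minor2 x0 y0 x3 y3 <= 7.190313650e-4.
  by have := minor2_itv _ _ _ _ hx0 hy0 hx3 hy3; Lra.lra.
have m12 : 2.372008290e-4 <= minor2 x1 y1 x2 y2 <= 2.379473605e-4.
  by have := minor2_itv _ _ _ _ hx1 hy1 hx2 hy2; Lra.lra.
have m13 : 1.1756034344e-3 <= minor2 x1 y1 x3 y3 <= 1.1782455916e-3.
  by have := minor2_itv _ _ _ _ hx1 hy1 hx3 hy3; Lra.lra.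
have m23 : - 6.24e-7 <= minor2 x2 y2 x3 y3 <= 6.24e-7.
  by have := minor2_itv _ _ _ _ hx2 hy2 hx3 hy3; Lra.lra.
have lagrange : g00 * g11 - g01 * g01 =
    minor2 x0 y0 x1 y1 * minor2 x0 y0 x1 y1 +
    minor2 x0 y0 x2 y2 * minor2 x0 y0 x2 y2 +
    minor2 x0 y0 x3 y3 * minor2 x0 y0 x3 y3 +
    minor2 x1 y1 x2 y2 * minor2 x1 y1 x2 y2 +
    minor2 x1 y1 x3 y3 * minor2 x1 y1 x3 y3 +
    minor2 x2 y2 x3 y3 * minor2 x2 y2 x3 y3.
  by rewrite /minor2 /g00 /g01 /g11; Lra.nra.
have := Rsqr_itv_sym _ m01; have := Rsqr_itv_sym _ m23.
have := Rsqr_itv _ m02; have := Rsqr_itv _ m03.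
have := Rsqr_itv _ m12; have := Rsqr_itv _ m13.
by rewrite lagrange; Lra.lra.
Qed.

(* The square of 1.3015041511e-3 exceeds 1.6939130553e-6, so the bound on
   [sigma_min] needs slightly more than the stated bounds on [\det G] and
   [lambda_min G]. *)
Lemma lambda_min_num (t z d : R) : t <= 1.1655562105 -> 1.974356e-6 <= d ->
  0 <= z -> d <= z * t -> 1.693915e-6 <= z.
Proof. by move=> *; Lra.nra. Qed.

End StdlibReals.

Lemma sum_ord2 (F : 'I_2 -> R) : \sum_i F i = F 0 + F 1.
Proof.
by rewrite !big_ord_recl big_ord0 addr0; congr (_ + F _); exact/val_inj.
Qed.

Lemma sum_ord4 (F : 'I_4 -> R) :
  \sum_i F i = F 0 + F 1 + F 2%:R + F 3%:R.
Proof.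
rewrite !big_ord_recl big_ord0 addr0 !addrA.
by congr (_ + F _ + F _ + F _); exact/val_inj.
Qed.

Lemma det_mx2 (G : 'M[R]_2) : \det G = G 0 0 * G 1 1 - G 0 1 * G 1 0.
Proof.
rewrite (expand_det_row _ 0) sum_ord2 /cofactor !det_mx11 !mxE /=.
have -> : lift 0 0 = 1 :> 'I_2 by exact/val_inj.
have -> : lift 1 0 = 0 :> 'I_2 by exact/val_inj.
by rewrite expr0 expr1 mul1r mulN1r mulrN.
Qed.

Lemma mxtrace2 (G : 'M[R]_2) : \tr G = G 0 0 + G 1 1.
Proof. exact: sum_ord2. Qed.

(** The other eigenvalue is [\tr G - z], and the product of the two is [\det G]. If [z <= 0], then
    [\tr G - z >= 0] and the product could not be positive. So both are positive, and
    [\det G = z * \tr G - z ^+ 2]. *)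
Lemma eigenvalue_sym2_bounds (G : 'M[R]_2) z : G^T = G ->
  0 < \det G -> 0 <= \tr G -> eigenvalue G z ->
  [/\ 0 < z, z <= \tr G & \det G <= z * \tr G].
Proof.
move=> symG; have G10 : G 1 0 = G 0 1 by rewrite -[in LHS]symG mxE.
rewrite det_mx2 mxtrace2 eigenvalue_mx2 G10 => d0 t0 /eqP e.
have zt : z * (G 0 0 + G 1 1 - z) = G 0 0 * G 1 1 - G 0 1 * G 0 1 by nra.
have z0 : 0 < z by nra.
by split => //; nra.
Qed.

(** Membership in the box in Stdlib's order and arithmetic, the form in which [gram_box] and
    [Lra.lra] take their hypotheses. *)
Lemma JboxP J a j : Jbox J ->
  (Jc a j - Jrad a j <= J a j <= Jc a j + Jrad a j)%coqR.
Proof.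
by move=> /(_ a j); rewrite ler_distl => /andP[/RleP ? /RleP ?].
Qed.

Theorem proposition8p3 (J : 'M[R]_(4, 2)) (hJ : Jbox J) :
  let G := J^T *m J in
  [/\ [/\ 0.8559892765%coqR <= G 0 0 <= 0.8559944643%coqR,
          0.5147600907%coqR <= G 0 1 <= 0.5147632101%coqR,
          0.5147600907%coqR <= G 1 0 <= 0.5147632101%coqR &
          0.3095598706%coqR <= G 1 1 <= 0.3095617462%coqR],
      1.9743508816e-6%coqR <= \det G <= 1.9829741725e-6%coqR,
      \rank J = 2%N,
      1.6939130553e-6%coqR <= lambda_min G /\
        lambda_max G <= 1.1655562105%coqR &
      [/\ 1.3015041511e-3%coqR <= sigma_min J,
          5e-4%coqR < 1.3015041511e-3%coqR :> R &
          kappa J <= 829.509%coqR]].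
Proof.
have := gram_box (x0 := - J 0 0) (x1 := J 1 0) (x2 := - J 2%:R 0) (x3 := J 3%:R 0)
  (y0 := - J 0 1) (y1 := J 1 1) (y2 := - J 2%:R 1) (y3 := J 3%:R 1).
have := JboxP 0 0 hJ; have := JboxP 1 0 hJ.
have := JboxP 2%:R 0 hJ; have := JboxP 3%:R 0 hJ.
have := JboxP 0 1 hJ; have := JboxP 1 1 hJ.
have := JboxP 2%:R 1 hJ; have := JboxP 3%:R 1 hJ.
rewrite !mxE /= => y3 y2 y1 y0 x3 x2 x1 x0 box; set G : 'M[R]_2 := J^T *m J.
have {box} [] := box; [Lra.lra.. |].
(* Back to MathComp's operations; the signs of the negated rows cancel in every product. *)
rewrite !RmultE !RoppE !mulrNN !RplusE RminusE.
have eG i j : G i j =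
    J 0 i * J 0 j + J 1 i * J 1 j + J 2%:R i * J 2%:R j + J 3%:R i * J 3%:R j.
  by rewrite mxE sum_ord4 !mxE.
have symG : G^T = G by rewrite trmx_mul trmxK.
have G10 : G 1 0 = G 0 1 by rewrite -[in LHS]symG mxE.
have detG : \det G = G 0 0 * G 1 1 - G 0 1 * G 0 1 by rewrite det_mx2 G10.
rewrite -!eG -detG => g00 g01 g11 dG.
(* The constant is the sum of the upper endpoints for [G 0 0] and [G 1 1]. *)
have trG : \tr G <= 1.1655562105%coqR.
  by rewrite mxtrace2; apply/RleP; rewrite -RplusE; Lra.lra.
have trG0 : 0 <= \tr G.
  by rewrite mxtrace2; apply/RleP; rewrite -RplusE -R0E; Lra.lra.
have dG0 : 0 < \det G by apply/RltP; rewrite -R0E; Lra.lra.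
have [lmin_ev _] := lambda_min_least symG.
have [lmax_ev _] := lambda_max_greatest symG.
have [lmin0 _ dG_le] := eigenvalue_sym2_bounds symG dG0 trG0 lmin_ev.
have [_ lmax_tr _] := eigenvalue_sym2_bounds symG dG0 trG0 lmax_ev.
have lmin_ge : (1.693915e-6 <= lambda_min G)%coqR.
  apply: (@lambda_min_num (\tr G) _ (\det G)); [exact/RleP| |exact/RleP/ltW|].
    by Lra.lra.
  exact/RleP.
have lmax_le : lambda_max G <= 1.1655562105%coqR := le_trans lmax_tr trG.
split.
- by rewrite G10; split; apply/andP; split; apply/RleP; Lra.lra.
- by apply/andP; split; apply/RleP; Lra.lra.
- apply/eqP; rewrite eqn_leq rank_leq_col /=.
  (* [G] is invertible because its determinant is positive, and [\rank (J^T *m J) <= \rank J]. *)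
  have rG : \rank G = 2%N by apply: mxrank_unit; rewrite unitmxE unitfE gt_eqF.
  by apply: leq_trans (mxrankM_maxr J^T J); rewrite -/G rG.
- by split => //; apply/RleP; Lra.lra.
split.
(* The constant is written as the root of its square, which lies below the sharper bound
   [lmin_ge]. *)
- rewrite /sigma_min -/G -[X in X <= _]ger0_norm; last first.
    by apply/RleP; rewrite -R0E; Lra.lra.
  rewrite -sqrtr_sqr; apply: ler_wsqrtr; apply/RleP.
  by rewrite expr2 -RmultE; Lra.lra.
- by apply/RltP; Lra.lra.
(* Likewise, it remains to check [lambda_max G <= 829.509 ^+ 2 * lambda_min G]. *)
rewrite /kappa -/G -[X in _ <= X]ger0_norm; last first.
  by apply/RleP; rewrite -R0E; Lra.lra.
rewrite -sqrtr_sqr; apply: ler_wsqrtr; rewrite ler_pdivrMr //.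
by move: lmax_le => /RleP ?; apply/RleP; rewrite expr2 -!RmultE; Lra.lra.
Qed.
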